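(* Let $n\ge 1$ and let $K\subset\mathbb{R}^n$ be a non-empty convex bounded set. Then \[ \mathrm{G}_n(K-K)\leq\binom{2n}{n}\,\mathrm{G}_n\left(K+\left(-\tfrac{3}{4},\tfrac{3}{4}\right)^n\right). \]
   Context: For $M\subset\mathbb{R}^n$, $\mathrm{G}_n(M)=|M\cap\mathbb{Z}^n|$ denotes the lattice point enumerator. For non-empty $A,B\subset\mathbb{R}^n$, $A+B=\{a+b: a\in A,\ b\in B\}$ is the Minkowski sum and $A-B=A+(-B)$. $K$ is not assumed closed, nor to have non-empty interior. *)

(* Defs.v *)
From HB Require Import structures.
From mathcomp Require Import all_boot all_order all_algebra.
From mathcomp Require Import all_classical all_reals all_analysis.

Set Implicit Arguments.
Unset Strict Implicit.
Unset Printing Implicit Defensive.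

Import Order.TTheory GRing.Theory Num.Theory.
Import numFieldNormedType.Exports.

Local Open Scope classical_set_scope.
Local Open Scope ring_scope.

Definition minkowski_sum (R : realType) (n : nat) (A B : set 'rV[R]_n) :
  set 'rV[R]_n := [set a + b | a in A & b in B].

Definition minkowski_diff (R : realType) (n : nat) (A B : set 'rV[R]_n) :
  set 'rV[R]_n := minkowski_sum A (-%R @` B).

Definition integer_lattice (R : realType) (n : nat) : set 'rV[R]_n :=
  [set x : 'rV[R]_n | forall i, x ord0 i \is a Num.int].
Arguments integer_lattice R n _ : clear implicits.

(* [counting] is [+oo] on infinite sets, so no finiteness has to be assumed. *)
Definition lattice_points (R : realType) (n : nat) (M : set 'rV[R]_n) : \bar R :=
  counting (M `&` integer_lattice R n).

Definition open_cube (R : realType) (n : nat) (a b : R) : set 'rV[R]_n :=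
  [set x : 'rV[R]_n | forall i, x ord0 i \in `]a, b[].

Arguments open_cube {R} n a b _.

(* Main.v *)
(** Write L = K + (-1/4, 1/4)^n and Q = (-1/2, 1/2)^n, so that L - L contains
    the disjoint unit cubes z + Q for all lattice points z of K - K, and L + Q
    is K + (-3/4, 3/4)^n.  In terms of volumes,
      G(K - K) <= vol(L - L) <= C(2n, n) vol(L) <= C(2n, n) G(L + Q),
    the middle step being the Rogers-Shephard inequality.  Here vol(L) is
    replaced by the supremum V of #|S| / m^n over odd m and finite sets S of
    lattice points z with all cubes (z + Q) / m inside L, and Rogers-Shephard is
    proved by counting: with E the lattice points of a dilate of L by about
    p m, the pairs of E are sorted by their difference x.  If x lies in the
    dilate of L - L by j m, then E meets x + E in a translated dilate of L by
    (p - j) m, hence in at least #|S| (p - j - 1)^n points.  Summing over j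
    gives a discrete beta integral, and p -> oo yields
    G(K - K) #|S| / m^n <= C(2n, n) V^2; finally divide by V. *)
Require Import Defs.
From HB Require Import structures.
From mathcomp Require Import all_boot all_order all_algebra.
From mathcomp Require Import all_classical all_reals all_analysis.
From mathcomp Require Import zify ring lra.

Set Implicit Arguments.
Unset Strict Implicit.
Unset Printing Implicit Defensive.

Import Order.TTheory GRing.Theory Num.Theory.
Import numFieldNormedType.Exports.

Local Open Scope classical_set_scope.
Local Open Scope ring_scope.

(** * Binomial sums and a discrete beta integral *)

(** Sort the subsets of size [a + b + 1] of [{0, ..., N}] by their element [i] of rank [a + 1]: [a]
    elements lie below [i] and [b] above. The induction uses Pascal's rule instead. *)
Lemma sum_bin_conv (N a b : nat) :
  (\sum_(i < N.+1) 'C(i, a) * 'C(N - i, b) = 'C(N.+1, (a + b).+1))%N.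
Proof.
elim: N b => [|N IHN] b.
  by rewrite big_ord_recl big_ord0 /=; case: a b => [|a] [|b].
case: b => [|b]; rewrite big_ord_recr /=.
  rewrite subnn bin0 muln1 addn0 [RHS]binS; congr addn.
  rewrite -[a in RHS]addn0 -IHN.
  by apply: eq_bigr => i _; rewrite !bin0.
rewrite subnn bin0n muln0 addn0 addnS binS -(IHN b) -addnS -(IHN b.+1).
rewrite -big_split /=.
apply: eq_bigr => i _.
by rewrite subSn ?binS ?mulnDr // -ltnS.
Qed.

Lemma ffact_leq_exp (k n : nat) : (k ^_ n <= k ^ n)%N.
Proof.
elim: n => [|n IHn] //; rewrite ffactnSr expnSr.
by apply: leq_mul => //; apply: leq_subr.
Qed.

Lemma exp_leq_ffact (k n : nat) : ((k - n) ^ n <= k ^_ n)%N.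
Proof.
rewrite ffact_prod -[X in (_ ^ X)%N](card_ord n) -prod_nat_const.
by apply: leq_prod => i _; apply: leq_sub2l; apply: ltnW.
Qed.

Lemma exp_succ_sub (k n : nat) : (n.+1 * k ^ n <= k.+1 ^ n.+1 - k ^ n.+1)%N.
Proof.
elim: n => [|n IHn]; first by rewrite !expn1 expn0; lia.
have := leq_mul (leqnn k) IHn.
have : (k ^ n.+1 <= k.+1 ^ n.+1)%N by rewrite leq_exp2r.
rewrite [(k.+1 ^ n.+2)%N]expnS [(k ^ n.+2)%N]expnS mulnCA -expnS; nia.
Qed.

(** The sum is the discrete analogue of the integral of [n x^n (N - x)^(n-1)] over [[0, N]], which
    equals [N^(2n) / 'C(2n, n)]. Falling factorials replace powers, so that the convolution is
    exact; this costs the shift by [2 * n]. *)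
Lemma beta_sum_lower (n N : nat) : (0 < n)%N ->
  ((N - 2 * n) ^ (2 * n) <=
   'C(2 * n, n) * \sum_(i < N) i ^ n * ((N - i) ^ n - (N - i).-1 ^ n))%N.
Proof.
case: n => // n _; set n1 := n.+1.
case: N => [|N]; first by rewrite sub0n exp0n.
apply: leq_trans (exp_leq_ffact _ _) _.
(* Termwise, [i ^ n1] is at least [n1! 'C(i, n1)], and the difference of powers is at least
   [n1 (N - i)^n], hence at least [n1! 'C(N - i, n)]. *)
have h : (n1`! * n1`! * 'C(N.+1, 2 * n1) <=
    \sum_(i < N.+1) i ^ n1 * ((N.+1 - i) ^ n1 - (N.+1 - i).-1 ^ n1))%N.
  rewrite mul2n -addnn {4}/n1 addnS -sum_bin_conv big_distrr /=.
  apply: leq_sum => i _; rewrite mulnACA; apply: leq_mul.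
    by rewrite mulnC bin_ffact ffact_leq_exp.
  have -> : (N.+1 - i = (N - i).+1)%N by rewrite subSn // -ltnS.
  apply: leq_trans (exp_succ_sub _ _).
  rewrite /n1 factS -mulnA leq_mul2l mulnC bin_ffact ffact_leq_exp.
  by rewrite orbT.
apply: leq_trans (leq_mul (leqnn _) h).
rewrite -bin_ffact mulnC mulnA leq_mul2r.
have := @bin_fact (2 * n1) n1; rewrite leq_pmull // => /(_ isT).
by rewrite mul2n -addnn addnK => ->; rewrite leqnn orbT.
Qed.

(** * Counting pairs by their difference *)

(** From the first [j] satisfying [P] on, the drops of [H] telescope to at most [H j], which is at
    most [c]. *)
Lemma sum_drops_leq (p : nat) (P : pred nat) (H : nat -> nat) (c : nat) :
  (forall j, H j.+1 <= H j)%N -> (forall j, (j < p)%N -> P j -> (H j <= c)%N) ->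
  (\sum_(j < p) P j * (H j - H j.+1) <= c)%N.
Proof.
elim: p P H => [|p IHp] P H Hdec HP; first by rewrite big_ord0.
case P0: (P 0%N).
  apply: leq_trans (HP _ (ltn0Sn p) P0).
  have -> : H 0%N = (\sum_(j < p.+1) (H j - H j.+1) + H p.+1)%N.
    elim: p.+1 => [|q IHq]; first by rewrite big_ord0.
    by rewrite big_ord_recr /= -addnA subnK.
  apply: leq_trans (leq_addr _ _); apply: leq_sum => j _.
  by case: (P j); rewrite ?mul1n ?mul0n.
rewrite big_ord_recl /= P0 mul0n add0n.
by apply: (IHp (fun j => P j.+1) (fun j => H j.+1)) => // j jp; apply: HP.
Qed.

Lemma sum_nat_of_bool (T : Type) (a : pred T) (s : seq T) :
  (\sum_(x <- s) a x = count a s)%N.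
Proof. by rewrite -sum1_count [RHS]big_mkcond. Qed.

(* The pairs of [E] with difference [x] correspond to [E :&: (x + E)]; the sum
   over [x] of their numbers is bounded below by its layers. *)
Lemma layer_cake (V : zmodType) (E : seq V) (T : nat -> seq V) (H : nat -> nat)
    (p : nat) :
  uniq E -> (forall j, uniq (T j)) -> (forall j, H j.+1 <= H j)%N ->
  (forall j x, (j < p)%N -> x \in T j ->
    (H j <= count (fun y => (y - x)%R \in E) E)%N) ->
  (\sum_(j < p) size (T j) * (H j - H j.+1) <= size E ^ 2)%N.
Proof.
move=> uE uT Hdec HT.
pose U := undup (flatten [seq T j | j <- iota 0 p]).
have sizeT j : (j < p)%N -> (size (T j) <= \sum_(x <- U) (x \in T j))%N.
  move=> jp; rewrite sum_nat_of_bool -size_filter.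
  apply: uniq_leq_size => // x xT; rewrite mem_filter xT mem_undup /=.
  by apply/flattenP; exists (T j) => //; rewrite map_f // mem_iota.
apply: (@leq_trans (\sum_(x <- U) count (fun y => (y - x)%R \in E) E)%N).
  apply: (@leq_trans
    (\sum_(j < p) \sum_(x <- U) (x \in T j) * (H j - H j.+1))%N).
    apply: leq_sum => j _; rewrite -big_distrl /= leq_mul2r.
    by rewrite sizeT ?orbT.
  rewrite exchange_big /=; apply: leq_sum => x _.
  by apply: (@sum_drops_leq p (fun j => x \in T j)) => // j jp; apply: HT.
rewrite (eq_bigr (fun x => \sum_(y <- E) ((y - x)%R \in E))%N); last first.
  by move=> x _; rewrite sum_nat_of_bool.
(* For fixed [y], the map sending [x] to [y - x] is injective, so at most [size E] values of [x]
   contribute. *)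
rewrite exchange_big /= -mulnn -[X in (_ <= X * _)%N]sum1_size big_distrl /=.
apply: leq_sum => y _; rewrite mul1n sum_nat_of_bool -size_filter.
rewrite -(size_map (fun x => y - x)); apply: uniq_leq_size.
  rewrite map_inj_uniq ?filter_uniq ?undup_uniq //.
  by move=> x1 x2 /addrI /oppr_inj.
by move=> z /mapP[x]; rewrite mem_filter => /andP[xE _] ->.
Qed.

(** * Integer points of cubes, and their enumeration *)

Lemma eq_digits (l a b : nat) (z z' c : int) :
  (a < l.-1)%N -> (b < l.-1)%N ->
  l%:Z * z + c + a%:Z = l%:Z * z' + c + b%:Z -> z = z' /\ a = b.
Proof.
move=> al bl e; have zz : z = z' by nia.
by split=> //; move: e; rewrite zz; lia.
Qed.

(** An open interval of length [l > 0] contains at least [l - 1] consecutive integers. Points of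
    different cubes [v + l (z + Q)] differ by uniqueness of division by [l]. *)
Lemma lattice_cubes (R : realType) (n : nat) (S : seq 'rV[int]_n) (l : nat)
    (v : 'rV[R]_n) :
  uniq S ->
  exists T : seq 'rV[int]_n, [/\ uniq T, size T = (size S * l.-1 ^ n)%N &
    forall y, y \in T -> exists2 z, z \in S &
      forall i, `|(y 0 i)%:~R - v 0 i - l%:R * (z 0 i)%:~R| < l%:R / 2].
Proof.
move=> uS.
(* The least integer strictly above the left end of the interval for [z = 0]. *)
pose w i := Num.floor (v 0 i - l%:R / 2) + 1.
pose f (z : 'rV[int]_n) (u : {ffun 'I_n -> 'I_l.-1}) : 'rV[int]_n :=
  \row_i (l%:Z * z 0 i + w i + (u i : nat)%:Z).
exists [seq f z u | z <- S, u <- enum {ffun 'I_n -> 'I_l.-1}]; split.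
- apply: allpairs_uniq => //; first exact: enum_uniq.
  move=> [z u] [z' u'] _ _ /= /rowP fE.
  have zu i : z 0 i = z' 0 i /\ u i = u' i.
    have := fE i; rewrite !mxE.
    by case/(eq_digits (ltn_ord (u i)) (ltn_ord (u' i))) => -> /val_inj.
  by congr pair; [apply/rowP | apply/ffunP] => i; case: (zu i).
- by rewrite size_allpairs -cardE card_ffun !card_ord.
- move=> y /allpairsP[[z u] /= [zS _ ->]]; exists z => // i.
  rewrite !mxE /w !intrD intrM.
  have ui := ltn_ord (u i).
  have /andP[h1 h2] : (Num.floor (v 0 i - l%:R / 2))%:~R <= v 0 i - l%:R / 2 <
      (Num.floor (v 0 i - l%:R / 2))%:~R + 1.
    by have := floor_itv (v 0 i - l%:R / 2); rewrite intrD.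
  have : (u i)%:R + 2 <= l%:R :> R by rewrite -natrD ler_nat; lia.
  have : 0 <= (u i)%:R :> R by [].
  rewrite ltr_norml -!pmulrn; move: h1 h2; set F := (Num.floor _)%:~R.
  by move=> *; apply/andP; split; lra.
Qed.

(** For odd [m] no integer is halfway between two multiples of [m], which makes the last inequality
    strict. The shift by [m./2] turns rounding into Euclidean division. *)
Lemma odd_nearest_multiple (m : nat) (x : int) : odd m ->
  exists q : int, exists2 r : nat, (r < m)%N &
    x + (m./2)%:Z = m%:Z * q + r%:Z /\ 2 * `|m%:Z * q - x| < m%:Z.
Proof.
move=> m_odd; have mE := odd_double_half m; rewrite m_odd in mE.
have := divz_eq (x + (m./2)%:Z) m%:Z.
have := @modz_ge0 (x + (m./2)%:Z) m%:Z; have := @ltz_pmod (x + (m./2)%:Z) m%:Z.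
move: (divz _ _) (modz _ _) => q r r_lt r_ge0 qr.
have {}r_lt : r < m%:Z by apply: r_lt; lia.
have {}r_ge0 : 0 <= r by apply: r_ge0; lia.
exists q; exists `|r|%N; first by lia.
have h : m%:Z * q = x + (m./2)%:Z - r by rewrite qr; ring.
by rewrite h; split; lia.
Qed.

(** Rounding [z / m] to the nearest lattice point lands in [G], and [z] is recovered from that point
    and one of [m ^ n] remainders. *)
Lemma size_subdivision (n m : nat) (S G : seq 'rV[int]_n) :
  odd m -> uniq S ->
  (forall z w : 'rV[int]_n, z \in S ->
    (forall i, 2 * `|m%:Z * w 0 i - z 0 i| < m%:Z) -> w \in G) ->
  (size S <= size G * m ^ n)%N.
Proof.
move=> m_odd uS SG.
have m0 : (0 < m)%N by case: m m_odd {SG}.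
pose f (g : 'rV[int]_n) (u : {ffun 'I_n -> 'I_m}) : 'rV[int]_n :=
  \row_i (m%:Z * g 0 i + (u i : nat)%:Z - (m./2)%:Z).
have -> : (size G * m ^ n)%N =
    size [seq f g u | g <- G, u <- enum {ffun 'I_n -> 'I_m}].
  by rewrite size_allpairs -cardE card_ffun !card_ord.
apply: uniq_leq_size => // z zS.
have /choice [q /choice [r qr]] : forall i, exists q (r : 'I_m),
    z 0 i + (m./2)%:Z = m%:Z * q + r%:Z /\ 2 * `|m%:Z * q - z 0 i| < m%:Z.
  move=> i; have [q [r rm h]] := odd_nearest_multiple (z 0 i) m_odd.
  by exists q, (Ordinal rm).
apply/allpairsP; exists (\row_i q i, [ffun i => r i]); split => /=.
- by apply: (SG z) => // i; rewrite mxE; case: (qr i).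
- by rewrite mem_enum.
- apply/rowP => i; rewrite !mxE ffunE /=; case: (qr i) => h _.
  by rewrite -h addrK.
Qed.

Lemma bounded_lattice_enum (n b : nat) (F : set 'rV[int]_n) :
  (forall z, F z -> forall i, `|z 0 i| <= b%:Z) ->
  exists2 s : seq 'rV[int]_n, uniq s & forall z, (z \in s) = `[< F z >].
Proof.
move=> Fb.
pose f (u : {ffun 'I_n -> 'I_(2 * b).+1}) : 'rV[int]_n :=
  \row_i ((u i : nat)%:Z - b%:Z).
exists [seq z <- undup [seq f u | u <- enum {ffun 'I_n -> 'I_(2 * b).+1}] |
  `[< F z >]]; first by rewrite filter_uniq ?undup_uniq.
move=> z; rewrite mem_filter mem_undup.
apply/andb_idr => /asboolP Fz; apply/mapP.
have ub i : (`|(z 0 i + b%:Z)%R| < (2 * b).+1)%N.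
  by move: (z 0 i) (Fb z Fz i) => x; lia.
exists [ffun i => Ordinal (ub i)]; first by rewrite mem_enum.
by apply/rowP => i; rewrite mxE ffunE /=; have := Fb _ Fz i; lia.
Qed.

Lemma lattice_points_size (R : realType) (n : nat) (A : set 'rV[R]_n)
    (s : seq 'rV[int]_n) :
  uniq s -> (forall z, (z \in s) = `[< A (map_mx intr z) >]) ->
  lattice_points A = (size s)%:R%:E.
Proof.
move=> us sA.
have map_intr_inj : injective (@map_mx int R intr 1 n).
  move=> x y /rowP e; apply/rowP => i.
  by have := e i; rewrite !mxE => /intr_inj.
have AE : A `&` integer_lattice R n = [set` [seq map_mx intr z | z <- s]].
  apply/seteqP; split => [x [Ax xi]|x /= /mapP[z zs ->]]; last first.
    split; first by apply/asboolP; rewrite -sA.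
    by move=> i; rewrite mxE; apply: intr_int.
  have xE : x = map_mx intr (\row_i Num.floor (x 0 i)).
    by apply/rowP => i; rewrite !mxE; apply/esym; apply: floorK; exact: xi.
  by rewrite /= xE map_f // sA -xE; apply/asboolP.
rewrite /lattice_points AE /counting asboolT; last exact: finite_seq.
congr (_%:R%:E); rewrite -(size_map (@map_mx int R intr 1 n) s).
apply: perm_size; apply: uniq_perm.
- exact: finmap.fset_uniq.
- by rewrite map_inj_uniq.
- by move=> x; rewrite in_fset_set ?mem_setE //; exact: finite_seq.
Qed.

(** * Convexity and boundedness of thickened sets *)

(** With [e = 1/4] this is [L]; with [e = 3/4] it is [L + Q], the set on the right of the
    theorem. *)
Definition thicken (R : realType) (n : nat) (K : set 'rV[R]_n) (e : R) :
  set 'rV[R]_n := minkowski_sum K (open_cube n (- e) e).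

Lemma thickenP (R : realType) (n : nat) (K : set 'rV[R]_n) (e : R) y :
  thicken K e y <-> exists2 k, K k & forall i, `|y 0 i - k 0 i| < e.
Proof.
split=> [[k Kk [c ce <-]]|[k Kk yk]].
  exists k => // i; rewrite mxE addrAC subrr add0r ltr_norml.
  by have := ce i; rewrite in_itv.
exists k => //; exists (y - k); last by rewrite addrC subrK.
by move=> i; rewrite in_itv /= !mxE -ltr_norml.
Qed.

Lemma convex_set_comb (R : realType) (n : nat) (K : set 'rV[R]_n) a b s t :
  convex_set K -> K a -> K b -> 0 <= s -> 0 <= t -> 0 < s + t ->
  K ((s + t)^-1 *: (s *: a + t *: b)).
Proof.
move=> Kc Ka Kb s0 t0 st.
have l0 : 0 <= (s + t)^-1 * s by rewrite mulr_ge0 // invr_ge0 ltW.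
have l1 : (s + t)^-1 * s <= 1 by rewrite mulrC ler_pdivrMr // mul1r lerDl.
have := Kc a b (Itv01 l0 l1); rewrite !inE => /(_ Ka Kb).
rewrite /conv /=; congr K; rewrite scalerDr !scalerA; congr (_ + _ *: _).
by rewrite /unstable.onem; field; rewrite gt_eqF.
Qed.

(** Convexity of the thickened set, in the unnormalised form [s L + t L] inside [(s + t) L] that
    suits integer dilation factors. *)
Lemma thicken_comb (R : realType) (n : nat) (K : set 'rV[R]_n) (e : R)
    (a b y : 'rV[R]_n) (s t : R) :
  convex_set K -> thicken K e a -> thicken K e b ->
  0 <= s -> 0 <= t -> 0 < s + t ->
  (forall i, (s + t) * y 0 i = s * a 0 i + t * b 0 i) -> thicken K e y.
Proof.
move=> Kc /thickenP[k Kk ak] /thickenP[k' Kk' bk'] s0 t0 st yE; apply/thickenP.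
exists ((s + t)^-1 *: (s *: k + t *: k')); first exact: convex_set_comb.
move=> i; rewrite !mxE.
have -> : y 0 i - (s + t)^-1 * (s * k 0 i + t * k' 0 i) =
    (s + t)^-1 * (s * (a 0 i - k 0 i) + t * (b 0 i - k' 0 i)).
  have -> : y 0 i = (s + t)^-1 * (s * a 0 i + t * b 0 i).
    by rewrite -yE mulKf // gt_eqF.
  by ring.
rewrite normrM gtr0_norm ?invr_gt0 // ltr_pdivrMl //.
apply: le_lt_trans (ler_normD _ _) _.
rewrite !normrM (ger0_norm s0) (ger0_norm t0) mulrDl.
(* At least one weight is positive, which keeps the bound strict. *)
have [s_gt0|s_le0] := ltP 0 s.
  by rewrite ltr_leD ?ltr_pM2l // ler_wpM2l // ltW.
by rewrite ler_ltD ?ltr_pM2l ?ler_wpM2l ?(ltW (ak i)) //; lra.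
Qed.

Lemma bounded_set_coord (R : realType) (n : nat) (K : set 'rV[R]_n) :
  bounded_set K ->
  exists b : nat, forall k, K k -> forall i, `|k 0 i| <= b%:R.
Proof.
move=> [M [_ HM]].
exists (`|Num.ceil (M + 1)|)%N => k Kk i.
have /HM /(_ _ Kk) /= h : M < M + 1 by rewrite ltrDl.
apply: (@le_trans _ _ `|k|).
  rewrite [X in _ <= X]mx_normrE.
  by apply: (le_trans _ (le_bigmax _ _ (0, i))).
apply: le_trans h _; apply: le_trans (ceil_ge _) _.
by rewrite natr_absz ler_int ler_norm.
Qed.

Lemma bounded_set_lattice_enum (R : realType) (n : nat) (A : set 'rV[R]_n) :
  bounded_set A ->
  exists2 s : seq 'rV[int]_n,
    uniq s & forall z, (z \in s) = `[< A (map_mx intr z) >].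
Proof.
move=> /bounded_set_coord[b Ab].
apply: (@bounded_lattice_enum n b) => z Az i.
by have := Ab _ Az i; rewrite mxE -intr_norm pmulrn ler_int.
Qed.

Lemma bounded_set_minkowski_sum (R : realType) (n : nat)
    (A B : set 'rV[R]_n) :
  bounded_set A -> bounded_set B -> bounded_set (minkowski_sum A B).
Proof.
move=> [M [Mr AM]] [N [Nr BN]]; exists (M + 1 + (N + 1)); split.
  exact: num_real.
move=> x Mx _ [a Aa [b Bb <-]].
apply: le_trans (ler_normD _ _) _; apply: le_trans (ltW Mx).
by rewrite lerD ?(AM (M + 1)) ?(BN (N + 1)) ?ltrDl.
Qed.

Lemma bounded_set_open_cube (R : realType) (n : nat) (a b : R) :
  bounded_set (open_cube n a b).
Proof.
exists (`|a| + `|b|); split; first exact: num_real.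
move=> x abx y /= aby; apply: le_trans (ltW abx).
rewrite [X in X <= _]mx_normrE; apply: bigmax_le; first by rewrite addr_ge0.
move=> [i j] _ /=; rewrite ord1; have := aby j.
rewrite in_itv /= => /andP[ay yb]; rewrite ler_norml.
have := ler_norm b; have := lerNnormlW (lexx `|a|).
have := normr_ge0 a; have := normr_ge0 b.
by move=> *; apply/andP; split; lra.
Qed.

(** * A discrete Rogers-Shephard inequality *)

(** The cubes are [(z + Q) / m], disjoint for distinct [z]; for duplicate-free [S] their total
    volume is [size S / m ^ n]. *)
Definition inner_cubes (R : realType) (n : nat) (L : set 'rV[R]_n) (m : nat)
    (S : seq 'rV[int]_n) :=
  forall z, z \in S -> forall y : 'rV[R]_n,
    (forall i, `|m%:R * y 0 i - (z 0 i)%:~R| < 1 / 2) -> L y.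

(** Take [y] in [(p - j) m L + j m l + 2 k0]. By convexity [y] lies in [p m L + 2 k0], and so does
    [y - x], since subtracting [x] replaces [l] by [l']. The inner cubes, dilated by [(p - j) m],
    supply the integer points. *)
Lemma size_intersection (R : realType) (n : nat) (K : set 'rV[R]_n)
    (k0 : 'rV[R]_n) (m p j : nat) (S E : seq 'rV[int]_n)
    (l l' : 'rV[R]_n) (x : 'rV[int]_n) :
  convex_set K -> (0 < m)%N -> (j < p)%N -> uniq S -> uniq E ->
  inner_cubes (thicken K (1 / 4)) m S ->
  (forall y : 'rV[int]_n, (exists2 a, thicken K (1 / 4) a &
      forall i, (y 0 i)%:~R = (p * m)%:R * a 0 i + 2 * k0 0 i) -> y \in E) ->
  thicken K (1 / 4) l -> thicken K (1 / 4) l' ->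
  (forall i, (x 0 i)%:~R = (j * m)%:R * (l 0 i - l' 0 i)) ->
  (size S * (p - j).-1 ^ n <= count (fun y => (y - x)%R \in E) E)%N.
Proof.
move=> Kc m0 jp uS uE Sin EL Ll Ll' xE.
pose v : 'rV[R]_n := \row_i ((j * m)%:R * l 0 i + 2 * k0 0 i).
have [T [uT <- TS]] := lattice_cubes (p - j) v uS.
rewrite -size_filter; apply: uniq_leq_size => // y yT.
have [z zS yz] := TS _ yT.
have p_gt0 : 0 < (p - j)%:R :> R by rewrite ltr0n subn_gt0.
have m_gt0 : 0 < m%:R :> R by rewrite ltr0n.
have pE : (p * m)%:R = (p - j)%:R * m%:R + j%:R * m%:R :> R.
  by rewrite -!natrM -natrD; congr _%:R; nia.
have j_ge0 : 0 <= j%:R :> R by [].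
(* Undoing the dilation and translation puts [y] in the inner cube of [z]. *)
pose a : 'rV[R]_n := \row_i (((y 0 i)%:~R - v 0 i) / ((p - j)%:R * m%:R)).
have La : thicken K (1 / 4) a.
  apply: (Sin z) => // i; have := yz i; rewrite [a _ _]mxE.
  set d := (_ - v _ _).
  set q := (p - j)%:R in p_gt0 *; move=> dlt.
  have -> : m%:R * (d / (q * m%:R)) - (z 0 i)%:~R =
      (d - q * (z 0 i)%:~R) / q.
    by field; rewrite !gt_eqF.
  by rewrite normrM normfV (gtr0_norm p_gt0) ltr_pdivrMr //; lra.
have aE i : (y 0 i)%:~R = (p - j)%:R * m%:R * a 0 i + v 0 i.
  by rewrite mxE; field; rewrite !gt_eqF.
have s0 : 0 < (p - j)%:R * m%:R :> R by rewrite mulr_gt0.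
have t0 : 0 <= j%:R * m%:R :> R by rewrite mulr_ge0 // ltW.
have st0 : 0 < (p - j)%:R * m%:R + j%:R * m%:R :> R by rewrite ltr_pwDl.
have comb l1 : thicken K (1 / 4) l1 -> exists2 c, thicken K (1 / 4) c &
    forall i, (p * m)%:R * c 0 i =
      (p - j)%:R * m%:R * a 0 i + j%:R * m%:R * l1 0 i.
  move=> Ll1; pose c : 'rV[R]_n := \row_i
    (((p - j)%:R * m%:R * a 0 i + j%:R * m%:R * l1 0 i) / (p * m)%:R).
  have cE i : (p * m)%:R * c 0 i =
      (p - j)%:R * m%:R * a 0 i + j%:R * m%:R * l1 0 i.
    by rewrite mxE mulrCA mulfV ?mulr1 // pE gt_eqF.
  exists c => //; apply: (thicken_comb Kc La Ll1 (ltW s0) t0 st0) => i.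
  by rewrite -pE cE.
rewrite mem_filter; apply/andP; split; apply: EL.
  have [c Lc cE] := comb _ Ll'; exists c => // i.
  rewrite [LHS](_ : _ = (y 0 i)%:~R - (x 0 i)%:~R); last first.
    by rewrite !mxE intrD mulrNz.
  by rewrite cE xE aE [v _ _]mxE natrM; ring.
have [c Lc cE] := comb _ Ll; exists c => // i.
by rewrite cE aE [v _ _]mxE natrM; ring.
Qed.

Lemma thicken_center (R : realType) (n : nat) (K : set 'rV[R]_n) (e : R)
    (k y : 'rV[R]_n) :
  K k -> (forall i, `|y 0 i - k 0 i| < e) -> thicken K e y.
Proof. by move=> Kk yk; apply/thickenP; exists k. Qed.

(** Write [z = a - b] and [x / r = z + c] with [c] in [Q]; giving half of [c] to each of [a] and [b]
    explains the radius [1/4]. *)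
Lemma difference_cube (R : realType) (n : nat) (K : set 'rV[R]_n) (r : R)
    (x z : 'rV[R]_n) :
  0 < r -> minkowski_diff K K z ->
  (forall i, `|x 0 i - r * z 0 i| < r / 2) ->
  exists l l' : 'rV[R]_n, [/\ thicken K (1 / 4) l, thicken K (1 / 4) l' &
    forall i, x 0 i = r * (l 0 i - l' 0 i)].
Proof.
move=> r0 [a Ka [_ [b Kb <-] <-]] xz.
have [c cE] : exists c : 'rV[R]_n, forall i,
    x 0 i - r * (a 0 i - b 0 i) = r * c 0 i.
  exists (r^-1 *: x - (a - b)) => i.
  by rewrite !mxE; field; rewrite gt_eqF.
have c_lt i : `|c 0 i| < 1 / 2.
  have := xz i; rewrite !mxE cE normrM (gtr0_norm r0).
  by rewrite ltr_pM2l // div1r.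
have half_lt i : `|c 0 i / 2| < 1 / 4.
  by rewrite normrM [`|2^-1|]ger0_norm ?invr_ge0 //; have := c_lt i; lra.
exists (\row_i (a 0 i + c 0 i / 2)), (\row_i (b 0 i - c 0 i / 2)); split.
- by apply: (thicken_center Ka) => i; rewrite mxE addrC addKr.
- by apply: (thicken_center Kb) => i; rewrite mxE addrC addKr normrN.
- move=> i; have := cE i; rewrite !mxE => h.
  by rewrite -[LHS](subrK (r * (a 0 i - b 0 i))) h; field.
Qed.

(* A lattice point of [p m L + 2 k0] carries a unit cube inside [(p m + 2) L],
   since the unit cube around [2 k0] lies in [2 L]; this is what makes the inner
   cubes at scale [m] comparable with those at scale [p m + 2]. *)
Lemma exists_inner_cubes_sum (R : realType) (n : nat) (K : set 'rV[R]_n)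
    (Z S : seq 'rV[int]_n) (m p : nat) :
  (0 < n)%N -> K !=set0 -> convex_set K -> bounded_set K ->
  (0 < m)%N -> (0 < p)%N -> uniq Z -> uniq S ->
  (forall z, z \in Z -> minkowski_diff K K (map_mx intr z)) ->
  inner_cubes (thicken K (1 / 4)) m S ->
  exists E : seq 'rV[int]_n, [/\ uniq E,
    inner_cubes (thicken K (1 / 4)) (p * m + 2) E &
    (size Z * size S * \sum_(j < p)
       (j * m).-1 ^ n * ((p - j).-1 ^ n - (p - j).-2 ^ n) <= size E ^ 2)%N].
Proof.
move=> n0 [k0 Kk0] Kc Kb m0 p0 uZ uS ZK Sin.
pose F (z : 'rV[int]_n) := exists2 a, thicken K (1 / 4) a &
  forall i, (z 0 i)%:~R = (p * m)%:R * a 0 i + 2 * k0 0 i.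
have [b Kbd] := bounded_set_coord Kb.
have [|E uE EF] := @bounded_lattice_enum n ((p * m) * b.+1 + 2 * b) F.
  move=> z [a /thickenP[k Kk ak] zE] i.
  rewrite -(@ler_int R) intr_norm zE; apply: le_trans (ler_normD _ _) _.
  rewrite -pmulrn natrD; apply: lerD; rewrite normrM normr_nat.
    rewrite [X in _ <= X]natrM; apply: ler_wpM2l => //.
    have := ak i; have := Kbd _ Kk i; rewrite -[b.+1%:R]natr1.
    have : `|a 0 i| <= `|a 0 i - k 0 i| + `|k 0 i|.
      by rewrite -[X in `|X| <= _](subrK (k 0 i)) ler_normD.
    by lra.
  by rewrite [X in _ <= X]natrM; apply: ler_wpM2l => //; apply: Kbd.
have EP z : F z -> z \in E by move=> Fz; rewrite EF; apply/asboolP.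
exists E; split => //.
  move=> z; rewrite EF => /asboolP[a La zE] y yz.
  (* Chosen so that [(p m + 2) y = p m a + 2 c]. *)
  pose c : 'rV[R]_n :=
    \row_i (k0 0 i + ((p * m + 2)%:R * y 0 i - (z 0 i)%:~R) / 2).
  have Lc : thicken K (1 / 4) c.
    apply: (thicken_center Kk0) => i; rewrite mxE addrC addKr.
    by rewrite normrM [`|2^-1|]ger0_norm ?invr_ge0 //; have := yz i; lra.
  apply: (@thicken_comb _ _ _ _ a c y (p * m)%:R 2) => // i.
  by rewrite mxE zE natrD; field.
(* [T j] lists integer points of the cubes [j m (z + Q)], which lie in [j m (L - L)]. *)
have /choice[T TP] : forall j, exists T : seq 'rV[int]_n,
    [/\ uniq T, size T = (size Z * (j * m).-1 ^ n)%N &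
    forall x, x \in T -> exists2 z, z \in Z & forall i,
      `|(x 0 i)%:~R - (j * m)%:R * (z 0 i)%:~R| < (j * m)%:R / 2 :> R].
  move=> j; have [T [uT sT TZ]] := lattice_cubes (j * m) (0 : 'rV[R]_n) uZ.
  exists T; split=> // x /TZ[z zZ h]; exists z => // i.
  by have := h i; rewrite mxE subr0.
pose H j := (size S * (p - j).-1 ^ n)%N.
apply: leq_trans (@layer_cake _ E T H p uE _ _ _).
- rewrite big_distrr /=; apply: leq_sum => j _.
  have [_ -> _] := TP j.
  by rewrite /H subnS -mulnBr mulnACA.
- by move=> j; case: (TP j).
- by move=> j; rewrite /H leq_mul2l leq_exp2r // subnS leq_pred orbT.
- move=> j x jp xT; have [_ _ /(_ _ xT)[z zZ xz]] := TP j.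
  (* A strict upper bound on an absolute value is positive; a coordinate to read it in exists
     because [n] is positive. *)
  have jm0 : 0 < (j * m)%:R :> R.
    by move: (le_lt_trans (normr_ge0 _) (xz (Ordinal n0))); lra.
  have [|l [l' [Ll Ll' xE]]] :=
    @difference_cube _ _ K _ (map_mx intr x) (map_mx intr z) jm0 (ZK _ zZ).
    by move=> i; rewrite !mxE; apply: xz.
  apply: (size_intersection Kc m0 jp uS uE Sin EP Ll Ll') => i.
  by rewrite -xE mxE.
Qed.

(** Taking [p = q + 2 n + 2] absorbs every shift, leaving the pure power [q ^ (2 * n)]; the new
    scale is [q m] plus a term independent of [q]. *)
Lemma exists_inner_cubes_bound (R : realType) (n : nat) (K : set 'rV[R]_n)
    (Z S : seq 'rV[int]_n) (m q : nat) :
  (0 < n)%N -> K !=set0 -> convex_set K -> bounded_set K ->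
  (0 < m)%N -> uniq Z -> uniq S ->
  (forall z, z \in Z -> minkowski_diff K K (map_mx intr z)) ->
  inner_cubes (thicken K (1 / 4)) m S ->
  exists E : seq 'rV[int]_n, [/\ uniq E,
    inner_cubes (thicken K (1 / 4)) (q * m + ((2 * n).+2 * m + 2)) E &
    (size Z * size S * m ^ n * q ^ (2 * n) <= 'C(2 * n, n) * size E ^ 2)%N].
Proof.
move=> n0 K0 Kc Kb m0 uZ uS ZK Sin.
set N := (q + 2 * n)%N.
have [E [uE Ein szE]] :=
  exists_inner_cubes_sum n0 K0 Kc Kb m0 (ltn0Sn N.+1) uZ uS ZK Sin.
exists E; split=> //; first by move: Ein; congr inner_cubes; rewrite /N; lia.
have := leq_mul (leqnn 'C(2 * n, n)) szE; apply: leq_trans.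
have := beta_sum_lower N n0; rewrite {1}/N addnK.
set B := (\sum_(i < N) _)%N => hB.
(* Drop the first and last terms; for [j = i + 1], [j m - 1] is at least [i m], and
   [p - j - 1 = N - i]. *)
have hS : (m ^ n * B <= \sum_(j < N.+2)
    (j * m).-1 ^ n * ((N.+2 - j).-1 ^ n - (N.+2 - j).-2 ^ n))%N.
  rewrite big_ord_recl big_ord_recr /= addnCA.
  apply: leq_trans (leq_addr _ _); rewrite /B big_distrr /=.
  apply: leq_sum => i _; rewrite mulnA -expnMn /bump /=; apply: leq_mul.
    by rewrite leq_exp2r //; nia.
  have -> : ((N.+2 - (1 + i)).-1 = N - i)%N by lia.
  by [].
apply: leq_trans (leq_mul (leqnn _) hB) _.
by rewrite mulnCA -[(_ * m ^ n * B)%N]mulnA !leq_mul.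
Qed.

(** * Comparison with lattice points and passage to the limit *)

(** The counterpart of [vol(L) <= G(L + Q)]: each centre [z / m] lies in [L], and rounding it moves
    each coordinate by less than [1/2]. *)
Lemma size_inner_cubes (R : realType) (n : nat) (K : set 'rV[R]_n)
    (S G : seq 'rV[int]_n) (m : nat) :
  odd m -> uniq S -> inner_cubes (thicken K (1 / 4)) m S ->
  (forall w, thicken K (3 / 4) (map_mx intr w) -> w \in G) ->
  (size S <= size G * m ^ n)%N.
Proof.
move=> m_odd uS Sin KG.
have m_gt0 : 0 < m%:R :> R by rewrite ltr0n; case: m m_odd {Sin}.
apply: size_subdivision => // z w zS wz; apply: KG.
pose y : 'rV[R]_n := m%:R^-1 *: map_mx intr z.
have /thickenP[k Kk yk] : thicken K (1 / 4) y.
  apply: (Sin z zS) => i.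
  by rewrite !mxE mulVKf ?gt_eqF // subrr normr0 divr_gt0.
apply: (thicken_center Kk) => i; rewrite mxE.
have wy : `|(w 0 i)%:~R - y 0 i| < 1 / 2.
  have -> : (w 0 i)%:~R - y 0 i = m%:R^-1 * (m%:Z * w 0 i - z 0 i)%:~R.
    by rewrite !mxE intrB intrM mulrBr mulKf ?gt_eqF.
  rewrite normrM gtr0_norm ?invr_gt0 // ltr_pdivrMl // -intr_norm.
  have := wz i; rewrite -(ltr_int R) intrM -!pmulrn; lra.
rewrite -[X in X - _](subrK (y 0 i)) -addrA.
by apply: le_lt_trans (ler_normD _ _) _; have := yk i; lra.
Qed.

Lemma le_of_asymptotic (R : realType) (X Y : R) (m c N : nat) :
  0 <= Y ->
  (forall q, odd q -> X * q%:R ^+ N <= Y * (q * m + c)%:R ^+ N) ->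
  X <= Y * m%:R ^+ N.
Proof.
move=> Y0 XY.
have -> : Y * m%:R ^+ N = Y * (m%:R + c%:R * 0) ^+ N :> R.
  by rewrite mulr0 addr0.
(* Sample at [q = 2 k + 1] and divide by [q ^ N]; [harmonic k], which is [1 / (k + 1)], dominates
   [1 / q]. *)
pose f k : R := Y * (m%:R + c%:R * harmonic k) ^+ N.
have f_cvg : f @ \oo --> Y * (m%:R + c%:R * 0) ^+ N.
  apply: cvgM; first exact: cvg_cst.
  apply: (@cvg_comp _ _ _ (fun k => m%:R + c%:R * harmonic k)
    (fun x : R => x ^+ N) _ _ _ _ (@exprn_continuous _ N _)).
  apply: cvgD; first exact: cvg_cst.
  by apply: cvgM; [exact: cvg_cst | exact: cvg_harmonic].
apply: (cvgr_to_ge f_cvg); apply: nearW => k.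
have q0 : 0 < (2 * k).+1%:R :> R by rewrite ltr0n.
have := XY (2 * k).+1; rewrite /= mul2n odd_double -mul2n => /(_ isT).
rewrite -ler_pdivlMr ?exprn_gt0 // -mulrA -expr_div_n => /le_trans; apply.
rewrite /f ler_wpM2l //; apply: lerXn2r.
- by rewrite nnegrE divr_ge0.
- by rewrite nnegrE addr_ge0 // mulr_ge0 // invr_ge0.
rewrite natrD natrM mulrDl mulrAC mulfV ?gt_eqF // mul1r lerD2l ler_wpM2l //.
by rewrite lef_pV2 ?posrE ?ltr0n // ler_nat; lia.
Qed.

Lemma size_difference_bound (R : realType) (n : nat) (K : set 'rV[R]_n)
    (Z G : seq 'rV[int]_n) :
  (0 < n)%N -> K !=set0 -> convex_set K -> bounded_set K -> uniq Z ->
  (forall z, z \in Z -> minkowski_diff K K (map_mx intr z)) ->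
  (forall w, thicken K (3 / 4) (map_mx intr w) -> w \in G) ->
  (size Z <= 'C(2 * n, n) * size G)%N.
Proof.
move=> n0 K0 Kc Kb uZ ZK KG.
have [->//|Z_neq0] := posnP (size Z).
(* The supremum [V] of [A] stands for [vol(L)]; odd scales let rounding bound [A] by [size G]. *)
pose A : set R := [set x | exists m S, [/\ odd m, uniq S,
  inner_cubes (thicken K (1 / 4)) m S & x = (size S)%:R / m%:R ^+ n]].
have odd_gt0 (m : nat) : odd m -> 0 < m%:R :> R by rewrite ltr0n; case: m.
have ubA : ubound A (size G)%:R.
  move=> _ [m [S [m_odd uS Sin ->]]].
  rewrite ler_pdivrMr ?exprn_gt0 ?odd_gt0 // -natrX -natrM ler_nat.
  exact: size_inner_cubes KG.
have [k Kk] := K0.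
(* One cube near [k] gives [V > 0]: its points are within [3 / (2 m)] of [k] in each coordinate, and
   [7] is the first odd [m] making this less than [1/4]. *)
have A_7 : A (7%:R ^+ n)^-1.
  exists 7%N, [:: \row_i Num.floor (7 * k 0 i)].
  split=> //; last by rewrite div1r.
  move=> z; rewrite inE => /eqP -> y yz; apply: (thicken_center Kk) => i.
  have := yz i; rewrite mxE !ltr_norml.
  have := floor_itv (7 * k 0 i); rewrite intrD.
  by move=> /andP[? ?] /andP[? ?]; apply/andP; split; lra.
have supA : has_sup A by split; [exists (7%:R ^+ n)^-1 | exists (size G)%:R].
set V := sup A.
have V_gt0 : 0 < V.
  by apply: lt_le_trans (ub_le_sup supA.2 A_7); rewrite invr_gt0 exprn_gt0.
set C : R := ('C(2 * n, n))%:R.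
have C_ge0 : 0 <= C by [].
(* The list [E] at scale [M] is itself measured by [V], so [size E] is at most [V M^n]; letting [q]
   grow then replaces [M / q] by [m]. *)
have bound x : A x -> (size Z)%:R * x <= C * V ^+ 2.
  move=> [m [S [m_odd uS Sin ->]]].
  have m_gt0 := odd_gt0 _ m_odd.
  have m_gt0n : (0 < m)%N by move: m_gt0; rewrite ltr0n.
  rewrite mulrA ler_pdivrMr ?exprn_gt0 //.
  rewrite -(@ler_pM2r _ (m%:R ^+ n)) ?exprn_gt0 //.
  have -> : C * V ^+ 2 * m%:R ^+ n * m%:R ^+ n = C * V ^+ 2 * m%:R ^+ (2 * n).
    by rewrite mul2n -addnn exprD mulrA.
  apply: (@le_of_asymptotic _ _ _ _ ((2 * n).+2 * m + 2)).
    by rewrite mulr_ge0 ?exprn_ge0 // ltW.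
  move=> q q_odd.
  have [E [uE Ein szE]] :=
    exists_inner_cubes_bound q n0 K0 Kc Kb m_gt0n uZ uS ZK Sin.
  set M := (q * m + _)%N in Ein *.
  (* Here [M = (q + 2 n + 2) m + 2], odd because [q] and [m] are. *)
  have M_odd : odd M.
    rewrite /M (_ : (2 * n).+2 = 2 * n.+1)%N ?mulnS //.
    by rewrite !(oddD, oddM) q_odd m_odd.
  have EV : (size E)%:R <= V * M%:R ^+ n.
    rewrite -ler_pdivrMr ?exprn_gt0 ?odd_gt0 //.
    by apply: (ub_le_sup supA.2); exists M, E; split.
  have {}szE : (size Z)%:R * (size S)%:R * m%:R ^+ n * q%:R ^+ (2 * n) <=
      C * (size E)%:R ^+ 2.
    by rewrite -!natrX -!natrM ler_nat.
  apply: le_trans szE _; rewrite -mulrA ler_wpM2l //.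
  rewrite [(2 * n)%N]mulnC exprM -exprMn.
  apply: lerXn2r => //; rewrite nnegrE // mulr_ge0 ?exprn_ge0 //.
  exact: ltW.
(* Take the supremum over [x] in [A]; one factor [V] then cancels and the other is at most
   [size G]. *)
have ZV : (size Z)%:R * V <= C * V ^+ 2.
  rewrite -ler_pdivlMl ?ltr0n //; apply: ge_sup => [|x Ax].
    by exists (7%:R ^+ n)^-1.
  by rewrite ler_pdivlMl ?ltr0n // bound.
rewrite -(@ler_nat R) natrM; apply: le_trans (_ : C * V <= _).
  by rewrite -(ler_pM2r V_gt0) -mulrA -expr2.
by rewrite ler_wpM2l //; apply: ge_sup => //; exists (7%:R ^+ n)^-1.
Qed.

Theorem theorem1p1 (R : realType) (n : nat) (n_ge1 : (1 <= n)%N)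
    (K : set 'rV[R]_n) (K_neq0 : K !=set0) (K_convex : convex_set K)
    (K_bounded : bounded_set K) :
  (lattice_points (minkowski_diff K K) <=
   ('C((2 * n)%N, n))%:R%:E *
   lattice_points (minkowski_sum K (open_cube n (- (3 / 4))%R (3 / 4)%R)))%E.
Proof.
have NK_bounded : bounded_set (-%R @` K).
  have [M [Mr KM]] := K_bounded.
  by exists M; split=> // x Mx _ [k Kk <-]; rewrite /= normrN; apply: (KM x).
(* Boundedness turns both counts into lengths of finite lists, hence the claim into an inequality of
   natural numbers. *)
have [Z uZ ZE] := bounded_set_lattice_enum
  (bounded_set_minkowski_sum K_bounded NK_bounded).
have [G uG GE] := bounded_set_lattice_enum
  (bounded_set_minkowski_sum K_bounded
    (bounded_set_open_cube n (- (3 / 4)) (3 / 4))).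
rewrite (lattice_points_size uZ ZE) (lattice_points_size uG GE).
rewrite -EFinM lee_fin -natrM ler_nat.
apply: (size_difference_bound n_ge1 K_neq0 K_convex K_bounded uZ) => z.
  by rewrite ZE => /asboolP.
by rewrite GE => ?; apply/asboolP.
Qed.
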